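(* Let $L\in\{\operatorname{Im}(\mathbb{I}),\mathbb{I}_0\}$, and let $\Lambda=\Lambda_{\rm ico}(t,W)$ be a generic icosahedral model set with underlying $\mathbb{Z}$-module $L$ (where $t\in\mathbb{R}^3$ and $W\subset\mathbb{R}^3$ is a window). Then, for every $\lambda\in\Lambda$, one has the identity $$\Phi\big((\Lambda\cap(\lambda+H^{(\tau,0,1)}))-\lambda\big)=\big\{z\in\mathbb{Z}[\zeta_5]\,\big|\,z^{\star_5}\in W_\lambda\big\},$$ where $.^{\star_5}$ is the Galois automorphism of $\mathbb{Q}(\zeta_5)/\mathbb{Q}$ defined by $\zeta_5\mapsto\zeta_5^3$ and $$W_\lambda:=\Phi^{\star}\big((W\cap((\lambda-t)^{\star}+H^{(\tau',0,1)}))-(\lambda-t)^{\star}\big).$$ Thus, the sets of the form $\Phi\big((\Lambda\cap(\lambda+H^{(\tau,0,1)}))-\lambda\big)$, where $\lambda\in\Lambda$, are cyclotomic model sets with underlying $\mathbb{Z}$-module $\mathbb{Z}[\zeta_5]$.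
   Context: Notation: $\tau=(1+\sqrt5)/2$; $.'$ is the non-trivial Galois automorphism of $\mathbb{Q}(\tau)$, so $\tau'=1-\tau$; $\mathbb{Z}[\tau]=\mathbb{Z}\oplus\mathbb{Z}\tau$; $\zeta_5=e^{2\pi i/5}$; $\mathbb{C}$ is identified with $\mathbb{R}^2$. Modules: The icosian ring $\mathbb{I}$ is the additive subgroup of the Hamiltonian quaternions $\mathbb{H}\cong\mathbb{R}^4$ (basis $1,i,j,k$) generated by all even permutations of the coordinates of $(\pm1,0,0,0)$, $\tfrac12(\pm1,\pm1,\pm1,\pm1)$, $\tfrac12(0,\pm1,\pm\tau',\tau)$. For $\alpha=a+bi+cj+dk$ put $\operatorname{Im}(\alpha)=(b,c,d)^t\in\mathbb{R}^3$. $\operatorname{Im}(\mathbb{I})$ is the set of imaginary parts of all elements of $\mathbb{I}$, and $\mathbb{I}_0$ is the set of imaginary parts of those elements of $\mathbb{I}$ with real part $0$. Explicitly, $\operatorname{Im}(\mathbb{I})=\tfrac12\{(\beta,\gamma,\delta)^t\in\mathbb{Z}[\tau]^3\mid\tau^2\beta+\tau\gamma+\delta\equiv0\ (\mathrm{mod}\ 2)\}$ and $\mathbb{I}_0=\tfrac12\{(\beta,\gamma,\delta)^t\in\mathbb{Z}[\tau]^3\mid\beta\equiv\tau\gamma\equiv\tau^2\delta\ (\mathrm{mod}\ 2)\}$. The star map $.^\star$ applies $.'$ to each coordinate of an element of $\mathbb{Q}(\tau)^3\supset L$. Icosahedral model sets: A window in $\mathbb{R}^m$ is a set $W\subset\mathbb{R}^m$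 with $\varnothing\neq\operatorname{int}(W)\subset W\subset\operatorname{cl}(\operatorname{int}(W))$ and $\operatorname{cl}(\operatorname{int}(W))$ compact. For $L\in\{\operatorname{Im}(\mathbb{I}),\mathbb{I}_0\}$, a window $W\subset\mathbb{R}^3$ and $t\in\mathbb{R}^3$, the icosahedral model set with underlying $\mathbb{Z}$-module $L$ is $\Lambda_{\rm ico}(t,W)=t+\{\alpha\in L\mid\alpha^\star\in W\}$. It is generic if $\operatorname{bd}(W)\cap L^\star=\varnothing$. Cyclotomic model sets with underlying $\mathbb{Z}$-module $\mathbb{Z}[\zeta_5]$: sets of the form $t+\{z\in\mathbb{Z}[\zeta_5]\mid z^{\star_5}\in V\}\subset\mathbb{R}^2$ with $t\in\mathbb{R}^2$, $V\subset\mathbb{R}^2$ a window, and $.^{\star_5}$ either the Galois automorphism of $\mathbb{Q}(\zeta_5)/\mathbb{Q}$ given by $\zeta_5\mapsto\zeta_5^3$ or its complex conjugate automorphism ($\zeta_5\mapsto\zeta_5^2$). $H^{(a,b,c)}$ is the hyperplane in $\mathbb{R}^3$ through the origin orthogonal to $(a,b,c)^t$. $\Phi:H^{(\tau,0,1)}\to\mathbb{C}$ is the $\mathbb{R}$-linear isomorphism determined by $(0,1,0)^t\mapsto1$, $\tfrac12(-1,-\tau',\tau)^t\mapsto\zeta_5$. $\Phi^\star:H^{(\tau',0,1)}\to\mathbb{C}$ is the $\mathbb{R}$-linear isomorphism determined by $(0,1,0)^t\mapsto1$, $\tfrac12(-1,-\tau,\tau')^t\mapsto\zeta_5^3$. 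*)

(* Defs.v *)
From HB Require Import structures.
From mathcomp Require Import all_boot all_order all_algebra all_fingroup.
From mathcomp Require Import all_classical all_reals all_analysis.
From mathcomp Require Export complex.

Set Implicit Arguments.
Unset Strict Implicit.
Unset Printing Implicit Defensive.

Import Order.TTheory GRing.Theory Num.Theory.
Import numFieldNormedType.Exports.

Local Open Scope classical_set_scope.
Local Open Scope ring_scope.
Local Open Scope complex_scope.

Section Algebra.

Definition subgroup_gen (V : zmodType) (S : set V) : set V :=
  smallest (fun G : set V => GRing.zmod_closed [in G]) S.

Definition ring_adjoin (F : fieldType) (x : F) : set F :=
  smallest (fun G : set F => GRing.subring_closed [in G]) [set x].

Definition field_adjoin (F : fieldType) (x : F) : set F :=
  smallest (fun G : set F => GRing.divring_closed [in G]) [set x].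

(* [s] restricts to a field automorphism of the subfield [K]; its values
   outside [K] are irrelevant.  In characteristic 0 it fixes the rationals. *)
Definition field_aut (F : fieldType) (K : set F) (s : F -> F) : Prop :=
  [/\ set_bij K K s, s 1 = 1, {in K &, {morph s : x y / x + y}}
    & {in K &, {morph s : x y / x * y}}].

End Algebra.

Definition window (T : topologicalType) (W : set T) : Prop :=
  [/\ W° !=set0, W `<=` closure W° & compact (closure W°)].

Definition boundary (T : topologicalType) (W : set T) : set T :=
  closure W `\` W°.

Definition translate (V : zmodType) (v : V) (A : set V) : set V :=
  [set v + x | x in A].

Definition affine_slice (V : zmodType) (A : set V) (p : V) (H : set V) : set V :=
  translate (- p) (A `&` translate p H).

Section Icosahedral.
Variable R : realType.

Definition cvec (n : nat) (s : seq R) : 'cV[R]_n := \col_(i < n) s`_i.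

Definition tau : R := (1 + Num.sqrt 5) / 2.
Definition tau' : R := 1 - tau.

Definition galois_tau : R -> R :=
  @xget (R -> R) id [set s | field_aut (field_adjoin tau) s /\
                   exists2 x, field_adjoin tau x & s x <> x].

Definition star (v : 'cV[R]_3) : 'cV[R]_3 := map_mx galois_tau v.

(* Quaternions are coordinate columns with respect to 1, i, j, k. *)
Definition icosian_seeds : set 'cV[R]_4 :=
  [set cvec 4 [:: (-1) ^+ b; 0; 0; 0] | b in [set: bool]] `|`
  [set 2^-1 *: (\col_i (-1) ^+ (s i)) | s in [set: {ffun 'I_4 -> bool}]] `|`
  [set 2^-1 *: cvec 4 [:: 0; (-1) ^+ b.1; (-1) ^+ b.2 * tau'; tau]
    | b in [set: bool * bool]].

Definition icosian : set 'cV[R]_4 :=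
  subgroup_gen [set row_perm s v | s in [set s : 'S_4 | ~~ odd_perm s]
                                 & v in icosian_seeds].

Definition quat_re (a : 'cV[R]_4) : R := a ord0 ord0.
Definition quat_im (a : 'cV[R]_4) : 'cV[R]_3 :=
  \col_(i < 3) a (lift ord0 i) ord0.

Definition Im_icosian : set 'cV[R]_3 := quat_im @` icosian.
Definition icosian0 : set 'cV[R]_3 :=
  quat_im @` (icosian `&` [set a | quat_re a = 0]).

Definition ico_model_set (L : set 'cV[R]_3) (t : 'cV[R]_3) (W : set 'cV[R]_3) :
    set 'cV[R]_3 :=
  translate t [set a | L a /\ W (star a)].

Definition generic_window (L W : set 'cV[R]_3) : Prop :=
  boundary W `&` (star @` L) = set0.

Definition hyperplane (n : 'cV[R]_3) : set 'cV[R]_3 :=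
  [set x | \sum_i n i ord0 * x i ord0 = 0].

Definition H_tau : set 'cV[R]_3 := hyperplane (cvec 3 [:: tau; 0; 1]).
Definition H_tau' : set 'cV[R]_3 := hyperplane (cvec 3 [:: tau'; 0; 1]).

Definition zeta5 : R[i] := cos (2 * pi / 5) +i* sin (2 * pi / 5).

Definition linear_iso_onto_C (H : set 'cV[R]_3) (f : 'cV[R]_3 -> R[i]) : Prop :=
  set_bij H setT f /\
  forall (a : R) u v, H u -> H v -> f (a *: u + v) = a%:C * f u + f v.

(* Only the restrictions to the respective planes are determined. *)
Definition Phi : 'cV[R]_3 -> R[i] :=
  @xget ('cV[R]_3 -> R[i]) (fun=> 0) [set f | [/\ linear_iso_onto_C H_tau f,
    f (cvec 3 [:: 0; 1; 0]) = 1
    & f (2^-1 *: cvec 3 [:: -1; - tau'; tau]) = zeta5]].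

Definition Phi_star : 'cV[R]_3 -> R[i] :=
  @xget ('cV[R]_3 -> R[i]) (fun=> 0) [set f | [/\ linear_iso_onto_C H_tau' f,
    f (cvec 3 [:: 0; 1; 0]) = 1
    & f (2^-1 *: cvec 3 [:: -1; - tau; tau']) = zeta5 ^+ 3]].

Definition Z_zeta5 : set R[i] := ring_adjoin zeta5.

Definition star5 (m : nat) : R[i] -> R[i] :=
  @xget (R[i] -> R[i]) id [set s | field_aut (field_adjoin zeta5) s /\ s zeta5 = zeta5 ^+ m].

Definition C_to_R2 (z : R[i]) : 'cV[R]_2 := cvec 2 [:: complex.Re z; complex.Im z].

Definition is_cyclotomic_model_set5 (S : set R[i]) : Prop :=
  exists (m : nat) (t : R[i]) (V : set R[i]),
    [/\ m = 3%N \/ m = 2%N, window (C_to_R2 @` V)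
      & S = translate t [set z | Z_zeta5 z /\ V (star5 m z)]].

Definition W_slice (W : set 'cV[R]_3) (t lambda : 'cV[R]_3) : set R[i] :=
  Phi_star @` affine_slice W (star (lambda - t)) H_tau'.

End Icosahedral.

(* Main.v *)
Require Import Defs.
From mathcomp Require Import all_boot all_order all_algebra all_fingroup.
From mathcomp Require Import all_classical all_reals all_analysis.
From mathcomp Require Import ring lra zify.

(** Everything rests on two parallel descriptions over the golden field.

    The plane.  For a vector [h] of the plane orthogonal to (tau, 0, 1) put
    [X = h1 - tau' h0] and [Y = -2 h0]; then [Phi h = X + Y zeta]
    ([PhiE], [plane_coord_point]).  The congruence that cuts
    out Im(I) inside 1/2 Z[tau]^3 becomes, on this plane, the condition
    that [X] and [Y] lie in Z[tau] ([Im_icosian_plane]); conversely the four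
    vectors with (X, Y) = (1, 0), (tau, 0), (0, 1), (0, tau) are imaginary
    parts of pure icosians ([plane_icosian0]).  So both modules [L] meet the
    plane in the same set, which [Phi] maps onto
    Z[tau] + Z[tau] zeta = Z[zeta] ([Phi_module]).

    The star maps.  The field Q(zeta) is Q(tau) + Q(tau) zeta, and its
    automorphism sending zeta to zeta^3 extends the conjugation of Q(tau):
    it sends [X + Y zeta] to [X' + Y' zeta^3].  Conjugating the coordinates
    of [h] exchanges tau and tau' and yields a point of the conjugate plane
    whose image under [Phi_star] is that same number.  Hence [Phi] intertwines
    the two star maps ([Phi_star_star]), and the first identity is a
    rewriting of the definitions since [L] is a group ([Phi_slice]).

    The window.  The slice of [W] through a point need not lie in the closure
    of its relative interior: a component of [W] that is a closed ball touching
    the plane from one side contributes an isolated point.  The cyclotomic window is therefore taken to be the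
    slice of the interior of [W], which is open, bounded and, by genericity,
    contains the origin ([window_plane_slice]).  Genericity also says that
    this smaller window selects the same points of the module. *)

Set Implicit Arguments.
Unset Strict Implicit.
Unset Printing Implicit Defensive.

Import Order.TTheory GRing.Theory Num.Theory.
Import numFieldNormedType.Exports.

Local Open Scope classical_set_scope.
Local Open Scope ring_scope.
Local Open Scope complex_scope.

(** * Subfields and field automorphisms given by their graphs *)

Section Subfields.
Variable F : fieldType.
Implicit Types (K : set F) (x y : F).

(** Closure conditions phrased with propositional rather than boolean
    membership, so that they apply to a classical set without conversion. *)
Definition subfield_set K :=
  [/\ K 1, forall x y, K x -> K y -> K (x - y)
    & forall x y, K x -> K y -> K (x / y)].

Definition subring_set K :=
  [/\ K 1, forall x y, K x -> K y -> K (x - y)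
    & forall x y, K x -> K y -> K (x * y)].

Lemma divring_closedP K : GRing.divring_closed [in K] <-> subfield_set K.
Proof.
split=> -[K1 KB KD]; split.
- by move: K1; rewrite inE.
- by move=> x y /mem_set Kx /mem_set Ky; apply: set_mem; apply: KB.
- by move=> x y /mem_set Kx /mem_set Ky; apply: set_mem; apply: KD.
- exact: mem_set.
- by move=> x y /set_mem Kx /set_mem Ky; apply: mem_set; apply: KB.
- by move=> x y /set_mem Kx /set_mem Ky; apply: mem_set; apply: KD.
Qed.

Lemma subring_closedP K : GRing.subring_closed [in K] <-> subring_set K.
Proof.
split=> -[K1 KB KD]; split.
- by move: K1; rewrite inE.
- by move=> x y /mem_set Kx /mem_set Ky; apply: set_mem; apply: KB.
- by move=> x y /mem_set Kx /mem_set Ky; apply: set_mem; apply: KD.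
- exact: mem_set.
- by move=> x y /set_mem Kx /set_mem Ky; apply: mem_set; apply: KB.
- by move=> x y /set_mem Kx /set_mem Ky; apply: mem_set; apply: KD.
Qed.

Lemma field_adjoin_eq x K :
  subfield_set K -> K x ->
  (forall K', subfield_set K' -> K' x -> K `<=` K') -> field_adjoin x = K.
Proof.
move=> Kf Kx Kmin; apply/seteqP; split.
  by apply: smallest_sub; [exact/divring_closedP | move=> _ ->].
by move=> y Ky K' [/divring_closedP K'f /(_ x erefl) K'x]; apply: Kmin Ky.
Qed.

Lemma ring_adjoin_eq x K :
  subring_set K -> K x -> (forall K', subring_set K' -> K' x -> K `<=` K') ->
  ring_adjoin x = K.
Proof.
move=> Kr Kx Kmin; apply/seteqP; split.
  by apply: smallest_sub; [exact/subring_closedP | move=> _ ->].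
by move=> y Ky K' [/subring_closedP K'f /(_ x erefl) K'x]; apply: Kmin Ky.
Qed.

Lemma subring0 K : subring_set K -> K 0.
Proof. by case=> K1 B _; rewrite -(subrr 1); apply: B. Qed.

Lemma subringN K x : subring_set K -> K x -> K (- x).
Proof.
move=> Kr Kx; rewrite -sub0r; case: (Kr) => _ B _.
by apply: B => //; apply: subring0.
Qed.

Lemma subringD K x y : subring_set K -> K x -> K y -> K (x + y).
Proof.
move=> Kr Kx Ky; rewrite -(opprK y); case: (Kr) => _ B _.
by apply: B => //; apply: subringN.
Qed.

Lemma subringM K x y : subring_set K -> K x -> K y -> K (x * y).
Proof. by move=> [_ _]; apply. Qed.

Lemma subring_int K (m : int) : subring_set K -> K m%:~R.
Proof.
move=> Kr; have Kn (n : nat) : K n%:R.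
  elim: n => [|n IH]; first exact: subring0.
  by rewrite -addn1 natrD; apply: subringD => //; case: Kr.
case: m => n; first exact: Kn.
by rewrite NegzE mulrNz; apply: subringN => //; exact: Kn.
Qed.

Lemma subfield_subring K : subfield_set K -> subring_set K.
Proof.
move=> [K1 B D]; split=> // x y Kx Ky.
by rewrite -(invrK y) -/(_ / _); apply: (D) => //; rewrite -(mul1r y^-1); apply: D.
Qed.

Lemma subfield_ratr K (q : rat) : subfield_set K -> K (ratr q).
Proof.
move=> Kf; have Kr := subfield_subring Kf.
by case: Kf => _ _ D; apply: D; apply: subring_int.
Qed.

(** The graph of an isomorphism between two subfields of [F]: stating
    closure properties of the graph avoids choosing a function that is only
    determined on the subfield.  The last clause makes the relation
    functional and injective. *)
Definition field_correspondence (G : F -> F -> Prop) :=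
  [/\ G 1 1, forall x x' y y', G x x' -> G y y' -> G (x - y) (x' - y'),
      forall x x' y y', G x x' -> G y y' -> G (x * y) (x' * y'),
      forall x x', G x x' -> G x^-1 x'^-1
    & forall x x', G x x' -> (x = 0 <-> x' = 0)].

Section Correspondence.
Variable (G : F -> F -> Prop).
Hypothesis hG : field_correspondence G.

Lemma correspondence_fun x x' x'' : G x x' -> G x x'' -> x' = x''.
Proof.
case: hG => _ B _ _ Z Gx Gx'; apply/eqP; rewrite -subr_eq0; apply/eqP.
by rewrite -(Z _ _ (B _ _ _ _ Gx Gx')) subrr.
Qed.

Lemma correspondence_inj x y x' : G x x' -> G y x' -> x = y.
Proof.
case: hG => _ B _ _ Z Gx Gx'; apply/eqP; rewrite -subr_eq0; apply/eqP.
by rewrite (Z _ _ (B _ _ _ _ Gx Gx')) subrr.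
Qed.

Lemma correspondenceD x x' y y' : G x x' -> G y y' -> G (x + y) (x' + y').
Proof.
case: hG => G1 B _ _ _ Gx Gy; rewrite -(opprK y) -(opprK y').
apply: (B) => //; rewrite -(sub0r y) -(sub0r y') -(subrr 1).
by apply: (B) => //; apply: B.
Qed.

Lemma correspondence_subfield : subfield_set [set x | exists x', G x x'].
Proof.
case: hG => G1 B M I _; split=> /=; first by exists 1.
  by move=> x y [x' ?] [y' ?]; exists (x' - y'); apply: B.
by move=> x y [x' ?] [y' ?]; exists (x' / y'); apply: M => //; apply: I.
Qed.

(** A correspondence whose domain and range coincide is an automorphism of
    that common field. *)
Lemma correspondence_aut :
  (forall y, (exists y', G y y') <-> exists x, G x y) ->
  exists2 s, field_aut [set x | exists x', G x x'] s & forall x x', G x x' -> s x = x'.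
Proof.
move=> GE; pose s x := xget 0 [set x' | G x x'].
have sE x x' : G x x' -> s x = x'.
  move=> Gx; apply: correspondence_fun (Gx).
  exact: (xgetPex 0 (ex_intro [set y | G x y] x' Gx)).
exists s => //; case: (hG) => G1 _ M _ _; split.
- split.
  + by move=> x [x' Gx] /=; rewrite (sE _ _ Gx); apply/GE; exists x.
  + move=> x y /set_mem[x' Gx] /set_mem[y' Gy].
    rewrite (sE _ _ Gx) (sE _ _ Gy) => xy; apply: correspondence_inj Gx _.
    by rewrite xy.
  + by move=> y /GE[x Gx]; exists x; [exists y | exact: sE].
- exact: sE.
- move=> x y /set_mem[x' Gx] /set_mem[y' Gy].
  by rewrite (sE _ _ Gx) (sE _ _ Gy); apply/sE/correspondenceD.
- move=> x y /set_mem[x' Gx] /set_mem[y' Gy].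
  by rewrite (sE _ _ Gx) (sE _ _ Gy); apply/sE/M.
Qed.

End Correspondence.

End Subfields.

Section AutRat.
Variables (F : numFieldType) (K : set F) (s : F -> F).
Hypotheses (Kf : subfield_set K) (sK : field_aut K s).

(** The prime field is fixed, because [1] is. *)
Lemma aut_ratr (q : rat) : s (ratr q) = ratr q.
Proof.
have Kr := subfield_subring Kf.
case: sK => _ s1 sD sM.
have K1 : K 1 by case: Kf.
have s0 : s 0 = 0.
  have K0 := mem_set (subring0 Kr).
  by apply: (addrI (s 0)); rewrite -sD // !addr0.
have sN x : K x -> s (- x) = - s x.
  move=> Kx; apply: (addrI (s x)); rewrite subrr -sD ?subrr //; apply: mem_set => //.
  exact: subringN.
have sn (n : nat) : s n%:R = n%:R.
  elim: n => // n IH; rewrite -addn1 natrD sD ?IH ?s1 //; apply: mem_set => //.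
  exact: (subring_int (Posz n)).
have sz (m : int) : s m%:~R = m%:~R.
  case: m => n; first exact: sn.
  rewrite NegzE mulrNz sN; first by congr (- _); exact: sn.
  exact: (subring_int (Posz n.+1)).
have d0 : (denq q)%:~R != 0 :> F by rewrite intr_eq0 denq_eq0.
apply: (mulIf d0); rewrite -{1}[X in _ * X]sz -sM.
- by rewrite /ratr divfK // sz.
- by apply: mem_set; apply: subfield_ratr.
- by apply: mem_set; apply: subring_int.
Qed.

End AutRat.

(** * The golden field and its conjugation *)

(** The exponent of 5 is even in a square and odd in five times a square. *)
Lemma rat_sqr_neq5 (q : rat) : q ^+ 2 != 5.
Proof.
apply/eqP => q2.
have dn0 : (denq q)%:~R != 0 :> rat by rewrite intr_eq0 denq_eq0.
have nd : numq q ^+ 2 = 5 * denq q ^+ 2.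
  apply/eqP; rewrite -(eqr_int rat) intrM !rmorphXn /= -[5%:~R]/(5 : rat) -q2 -exprMn.
  by rewrite -{2}(divq_num_den q) divfK.
have : logn 5 (`|numq q| ^ 2) = logn 5 (5 * `|denq q| ^ 2).
  by rewrite -!abszX -(abszM 5) nd.
have d0 : (0 < `|denq q|)%N by rewrite absz_gt0 denq_eq0.
by rewrite lognM ?expn_gt0 ?d0 // !lognX (@pfactorK 5 1) //; lia.
Qed.

Section Golden.
Variable R : realType.
Local Notation tau := (tau R).
Local Notation tau' := (tau' R).

Lemma tau_sqr : tau ^+ 2 = tau + 1.
Proof.
have h : Num.sqrt 5 ^+ 2 = 5 :> R by rewrite sqr_sqrtr // ler0n.
by rewrite /Defs.tau; field: h.
Qed.

(** The norm [a^2 + a b - b^2] of [a + b tau] is anisotropic over the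
    rationals: completing the square turns a zero into a rational square root
    of 5. *)
Lemma golden_norm_eq0 (a b : rat) : a ^+ 2 + a * b - b ^+ 2 = 0 -> a = 0 /\ b = 0.
Proof.
move=> N0; have [b0|b0] := eqVneq b 0.
  move: N0; rewrite b0 mulr0 expr0n /= addr0 subr0 => /eqP.
  by rewrite expf_eq0 /= => /eqP.
have /eqP[] := rat_sqr_neq5 ((2 * a + b) / b).
rewrite expr_div_n; apply/(canLR (mulfK (expf_neq0 2 b0)))/eqP.
by rewrite -subr_eq0 -(mulr0 4) -N0; apply/eqP; ring.
Qed.

Definition conj_tau (x x' : R) := exists a b : rat,
  x = ratr a + ratr b * tau /\ x' = ratr a + ratr b * tau'.

Lemma conj_tau_sym x x' : conj_tau x x' -> conj_tau x' x.
Proof.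
move=> [a [b [-> ->]]]; exists (a + b), (- b).
by rewrite !(rmorphD, rmorphN) /Defs.tau'; split; ring.
Qed.

(** A vanishing [a + b tau] has norm 0, hence [a = b = 0]; the inverse of
    [a + b tau] is its conjugate divided by its norm. *)
Lemma conj_tauP : field_correspondence conj_tau.
Proof.
have t2 := tau_sqr; have Z x x' : conj_tau x x' -> x = 0 -> x' = 0.
  move=> [a [b [-> ->]]] x0.
  have N0 : a ^+ 2 + a * b - b ^+ 2 = 0.
    apply: (fmorph_inj (@ratr R)); rewrite rmorph0 rmorphB rmorphD !rmorphM.
    have -> : 0 = (ratr a + ratr b * tau) * (ratr a + ratr b * tau').
      by rewrite x0 mul0r.
    by rewrite /Defs.tau'; ring: t2.
  by have [-> ->] := golden_norm_eq0 N0; rewrite rmorph0 mul0r addr0.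
split.
- by exists 1, 0; rewrite rmorph0 rmorph1 !mul0r addr0.
- move=> _ _ _ _ [a [b [-> ->]]] [c [d [-> ->]]]; exists (a - c), (b - d).
  by rewrite !rmorphB; split; ring.
- move=> _ _ _ _ [a [b [-> ->]]] [c [d [-> ->]]].
  exists (a * c + b * d), (a * d + b * c + b * d).
  rewrite !(rmorphD, rmorphM) /Defs.tau'; split; ring: t2.
- move=> x x' [a [b [xE x'E]]].
  have [N0|N0] := eqVneq (a ^+ 2 + a * b - b ^+ 2) 0.
    have [a0 b0] := golden_norm_eq0 N0; rewrite xE x'E a0 b0.
    by exists 0, 0; rewrite rmorph0 !mul0r addr0 invr0.
  have xx' : x * x' = ratr (a ^+ 2 + a * b - b ^+ 2).
    rewrite xE x'E rmorphB rmorphD !rmorphM /Defs.tau'; ring: t2.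
  exists ((a + b) / (a ^+ 2 + a * b - b ^+ 2)), (- b / (a ^+ 2 + a * b - b ^+ 2)).
  have divN q : ratr (q / (a ^+ 2 + a * b - b ^+ 2)) = ratr q / (x * x').
    by rewrite fmorph_div /= xx'.
  rewrite !divN.
  have : x * x' != 0 by rewrite xx' fmorph_eq0.
  rewrite mulf_eq0 negb_or => /andP[x0 x'0]; rewrite rmorphD rmorphN /=.
  split.
    have -> : ratr a = x' - ratr b * (1 - tau) by rewrite x'E /Defs.tau'; ring.
    by field; rewrite x0 x'0.
  have -> : ratr a = x - ratr b * tau by rewrite xE; ring.
  by rewrite /Defs.tau'; field; rewrite x0 x'0.
- by move=> x x' xx'; split; apply: Z => //; apply: conj_tau_sym.
Qed.
End Golden.

Section GoldenAutomorphism.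
Variable R : realType.
Local Notation tau := (tau R).
Local Notation tau' := (tau' R).

Lemma conj_tau_tau : conj_tau tau tau'.
Proof. by exists 0, 1; rewrite rmorph0 rmorph1 !mul1r !add0r. Qed.

Lemma tau'_neq_tau : tau' <> tau.
Proof.
rewrite /Defs.tau' => h; have t2 := tau_sqr R; have : tau = 1 / 2 by lra.
by move=> e; move: t2; rewrite e => t2; lra.
Qed.

Lemma field_adjoin_tau : field_adjoin tau = [set x | exists x', conj_tau x x'].
Proof.
apply: field_adjoin_eq.
- exact: correspondence_subfield (conj_tauP R).
- by exists tau'; exact: conj_tau_tau.
- move=> K Kf Kt _ [_ [a [b [-> _]]]]; have Kr := subfield_subring Kf.
  by apply: subringD => //; [|apply: subringM => //]; apply: subfield_ratr.
Qed.

(** An automorphism sends [tau] to a root of x^2 = x + 1, that is to [tau]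
    or to [tau']; fixing [tau] would make it the identity. *)
Lemma galois_tauE x x' : conj_tau x x' -> @galois_tau R x = x'.
Proof.
move=> xx'; rewrite /galois_tau; set S := [set s | _].
set g := xget _ S; have : S g.
  apply: xgetPex.
  have [|s sK sE] := @correspondence_aut R (@conj_tau R) (conj_tauP R).
    by move=> y; split=> -[z /conj_tau_sym]; exists z.
  exists s; split; rewrite field_adjoin_tau //.
  exists tau; first by exists tau'; exact: conj_tau_tau.
  by rewrite (sE _ _ conj_tau_tau); exact: tau'_neq_tau.
move: g => s /= [sK [y]]; move: sK; rewrite field_adjoin_tau.
set K := [set x | _] => sK [_ [c [d [-> _]]]].
have Kf : subfield_set K by exact: correspondence_subfield (conj_tauP R).
have Kr := subfield_subring Kf.
have Kt : K tau by exists tau'; exact: conj_tau_tau.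
have sE a b : s (ratr a + ratr b * tau) = ratr a + ratr b * s tau.
  have Ka := subfield_ratr a Kf; have Kb := subfield_ratr b Kf.
  case: (sK) => _ _ sD sM; have Kbt := subringM Kr Kb Kt.
  rewrite (sD _ _ (mem_set Ka) (mem_set Kbt)) (sM _ _ (mem_set Kb) (mem_set Kt)).
  by rewrite !(aut_ratr Kf sK).
have : (s tau - tau) * (s tau - tau') = 0.
  have st2 : s tau ^+ 2 = s tau + 1.
    case: sK => _ s1 sD sM.
    have K1 : K 1 by case: Kf.
    rewrite expr2 -(sM _ _ (mem_set Kt) (mem_set Kt)) -expr2 tau_sqr.
    by rewrite (sD _ _ (mem_set Kt) (mem_set K1)) s1.
  by have t2 := tau_sqr R; rewrite /Defs.tau'; ring: t2 st2.
rewrite sE => /eqP; rewrite mulf_eq0 !subr_eq0 => /orP[/eqP->//|/eqP st] _.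
by move: xx' => [a [b [-> ->]]]; rewrite sE st.
Qed.

Definition Z_tau : set R := [set x | exists m n : int, x = m%:~R + n%:~R * tau].

Lemma Z_tau_subring : subring_set Z_tau.
Proof.
have t2 := tau_sqr R; split.
- by exists 1, 0; rewrite mul0r addr0.
- move=> _ _ [a [b ->]] [c [d ->]]; exists (a - c), (b - d).
  by rewrite !intrB; ring.
- move=> _ _ [a [b ->]] [c [d ->]]; exists (a * c + b * d), (a * d + b * c + b * d).
  by rewrite !(intrD, intrM); ring: t2.
Qed.

Lemma Z_tau_tau : Z_tau tau.
Proof. by exists 0, 1; rewrite mul1r add0r. Qed.

Lemma Z_tau_tau' : Z_tau tau'.
Proof. by exists 1, (-1); rewrite /Defs.tau' mulN1r. Qed.

Lemma Z_tau_conj x : Z_tau x -> exists x', conj_tau x x'.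
Proof.
by move=> [m [n ->]]; exists (m%:~R + n%:~R * tau'), m%:~R, n%:~R; rewrite !ratr_int.
Qed.

(** Writing c for the cosine of x = 2 pi / 5, the equality of cos (3 x)
    and cos (2 x) gives (c - 1) (4 c^2 + 2 c - 1) = 0. *)
Lemma zeta5_re : 2 * cos (2 * pi / 5) = tau - 1 :> R.
Proof.
set x := 2 * pi / 5; set c := cos x.
have pi0 := pi_gt0 R.
have x0 : 0 < x by rewrite /x; lra.
have xpi : x < pi / 2 by rewrite /x; lra.
have c0 : 0 < c by apply: cos_gt0_pihalf; rewrite xpi andbT; lra.
have s0 : 0 < sin x by apply: sin_gt0_pi; rewrite x0 /=; lra.
have cs := cos2Dsin2 x; rewrite -/c in cs.
have c1 : c != 1.
  by apply/eqP => c1; rewrite c1 in cs; nra.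
have : 4 * c ^+ 3 - 3 * c = 2 * c ^+ 2 - 1.
  have e : cos (x + x + x) = cos (x + x).
    have -> : x + x + x = - (x + x) + pi *+ 2 by rewrite /x; field.
    by rewrite cosD2pi cosN.
  move: e; rewrite cosD cosD sinD -/c; nra.
move=> e; have : (c - 1) * (4 * c ^+ 2 + 2 * c - 1) = 0 by lra.
move/eqP; rewrite mulf_eq0 subr_eq0 (negbTE c1) /= => /eqP q.
have t2 := tau_sqr R.
have t1 : 1 / 2 < tau.
  have : 0 < Num.sqrt 5 :> R by rewrite sqrtr_gt0 ltr0n.
  by rewrite /Defs.tau; lra.
nra.
Qed.

Lemma zeta5_im_gt0 : 0 < sin (2 * pi / 5) :> R.
Proof. have pi0 := pi_gt0 R; apply: sin_gt0_pi; apply/andP; split; lra. Qed.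
End GoldenAutomorphism.

(** * The fifth cyclotomic field over the golden field *)

Section Zeta.
Variable R : realType.
Local Notation tau := (tau R).
Local Notation tau' := (tau' R).
Local Notation zeta := (zeta5 R).

Lemma complex_combE (x y : R) (w : R[i]) :
  x%:C + y%:C * w = (x + y * complex.Re w) +i* (y * complex.Im w).
Proof. by case: w => a b; simpc; congr (_ +i* _); ring. Qed.

Lemma ratr_combC (p q : rat) (x : R) :
  (ratr p + ratr q * x)%:C = ratr p + ratr q * x%:C :> R[i].
Proof. by rewrite rmorphD fmorph_rat /= rmorphM fmorph_rat. Qed.

(** [zeta] is a root of x^2 - 2 cos (2 pi / 5) x + 1. *)
Lemma zeta_sqr : zeta ^+ 2 = (tau - 1)%:C * zeta - 1.
Proof.
have c2 := zeta5_re R; have cs := cos2Dsin2 (2 * pi / 5 : R).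
rewrite -c2 /zeta5 expr2; simpc; congr (_ +i* _); last by ring.
by move: cs c2; move: (cos _) (sin _) => c s; lra.
Qed.

Lemma tauC_sqr : tau%:C ^+ 2 = tau%:C + 1 :> R[i].
Proof. by rewrite -rmorphXn tau_sqr rmorphD. Qed.

Lemma zeta3 : zeta ^+ 3 = (1 - tau)%:C * (zeta + 1).
Proof.
have z2 := zeta_sqr; have t2 := tauC_sqr.
move: z2; rewrite !rmorphB rmorph1 => z2.
by ring: z2 t2.
Qed.

(** The conjugate of the equation of [zeta] over Q(tau); this is why
    [zeta] to [zeta^3] is compatible with the conjugation of Q(tau). *)
Lemma zeta3_sqr : (zeta ^+ 3) ^+ 2 = (tau' - 1)%:C * zeta ^+ 3 - 1.
Proof.
have z2 := zeta_sqr; have t2 := tauC_sqr.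
move: z2; rewrite zeta3 /Defs.tau' !rmorphB rmorph1 => z2.
by ring: z2 t2.
Qed.

Lemma zeta_zeta3 : zeta = (zeta ^+ 3) ^+ 2.
Proof.
have z2 := zeta_sqr; have t2 := tauC_sqr.
move: z2; rewrite zeta3 !rmorphB rmorph1 => z2.
by ring: z2 t2.
Qed.

Lemma im_zeta : complex.Im zeta != 0.
Proof. by rewrite /=; have := zeta5_im_gt0 R; apply: lt0r_neq0. Qed.

Lemma im_zeta3 : complex.Im (zeta ^+ 3) != 0.
Proof.
have -> : zeta ^+ 3 = (1 - tau)%:C + (1 - tau)%:C * zeta by rewrite zeta3; ring.
rewrite complex_combE mulf_neq0 ?im_zeta // subr_eq0; apply/eqP => e.
by have := tau_sqr R; rewrite -e; lra.
Qed.

Lemma complex_free (x y : R) (w : R[i]) :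
  complex.Im w != 0 -> x%:C + y%:C * w = 0 -> x = 0 /\ y = 0.
Proof.
move=> w0; rewrite complex_combE => -[] /[swap] /eqP.
by rewrite mulf_eq0 (negbTE w0) orbF => /eqP ->; rewrite mul0r addr0.
Qed.

Definition conj_zeta (z z' : R[i]) := exists x x' y y' : R,
  [/\ conj_tau x x', conj_tau y y', z = x%:C + y%:C * zeta
    & z' = x'%:C + y'%:C * zeta ^+ 3].

(** Products correspond because [zeta] and [zeta ^+ 3] satisfy conjugate
    quadratic equations, and only 0 corresponds to 0 because neither number
    is real.  The inverse of [z = x + y zeta] is [u / N], where [u] is the
    complex conjugate of [z] and [N = z u] lies in Q(tau). *)
Lemma conj_zetaP : field_correspondence conj_zeta.
Proof.
have [G1 GB GM GV G0] := conj_tauP R.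
have GD := correspondenceD (conj_tauP R).
have Gt := conj_tau_tau R.
have Gz : conj_tau (0 : R) 0 by rewrite -(subrr 1); apply: GB.
have Gt1 : conj_tau (tau - 1) (tau' - 1) by apply: GB.
have z2 := zeta_sqr; have w2 := zeta3_sqr.
have M z z' w w' : conj_zeta z z' -> conj_zeta w w' -> conj_zeta (z * w) (z' * w').
  move=> [a [a' [b [b' [Ga Gb -> ->]]]]] [c [c' [d [d' [Gc Gd -> ->]]]]].
  exists (a * c - b * d), (a' * c' - b' * d').
  exists (a * d + b * c + (tau - 1) * (b * d)).
  exists (a' * d' + b' * c' + (tau' - 1) * (b' * d')).
  have Gbd := GM _ _ _ _ Gb Gd.
  split.
  - by apply: (GB) => //; apply: (GM).
  - by apply: (GD); [apply: (GD); apply: (GM)|apply: GM].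
  - move: z2; rewrite !(rmorphB, rmorphD, rmorphM) rmorph1 /= => z2; ring: z2.
  - move: (zeta ^+ 3) w2 => om; rewrite !(rmorphB, rmorphD, rmorphM) rmorph1 /= => w2.
    by ring: w2.
have Z z z' : conj_zeta z z' -> (z = 0 <-> z' = 0).
  move=> [a [a' [b [b' [Ga Gb -> ->]]]]]; split.
    move=> /(complex_free im_zeta)[/(G0 _ _ Ga) -> /(G0 _ _ Gb) ->].
    by rewrite mul0r addr0.
  move=> /(complex_free im_zeta3)[/(G0 _ _ Ga) -> /(G0 _ _ Gb) ->].
  by rewrite mul0r addr0.
split => //.
- by exists 1, 1, 0, 0; split; rewrite ?mul0r ?addr0.
- move=> _ _ _ _ [a [a' [b [b' [Ga Gb -> ->]]]]] [c [c' [d [d' [Gc Gd -> ->]]]]].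
  exists (a - c), (a' - c'), (b - d), (b' - d'); split; [exact: GB|exact: GB| |].
    by rewrite !rmorphB; ring.
  by rewrite !rmorphB; ring.
- move=> z z' /[dup] zz' [a [a' [b [b' [Ga Gb zE z'E]]]]].
  have [z0|z0] := eqVneq z 0.
    rewrite z0 (Z _ _ zz').1 // invr0.
    by exists 0, 0, 0, 0; split; rewrite ?mul0r ?addr0.
  have z'0 : z' != 0 by apply: contra z0 => /eqP/(Z _ _ zz') ->.
  (* The complex conjugate of zeta is (tau - 1) - zeta. *)
  pose N := a ^+ 2 + (tau - 1) * a * b + b ^+ 2.
  pose N' := a' ^+ 2 + (tau' - 1) * a' * b' + b' ^+ 2.
  have GN : conj_tau N N'.
    by rewrite /N /N' !expr2; do !apply: (GD); do !apply: (GM) => //.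
  pose u := (a + b * (tau - 1))%:C - b%:C * zeta.
  pose u' := (a' + b' * (tau' - 1))%:C - b'%:C * zeta ^+ 3.
  have uu' : conj_zeta u u'.
    exists (a + b * (tau - 1)), (a' + b' * (tau' - 1)), (0 - b), (0 - b'); split.
    + by apply: (GD) => //; apply: GM.
    + exact: GB.
    + by rewrite sub0r rmorphN mulNr.
    + by rewrite sub0r rmorphN mulNr.
  have zu : z * u = N%:C.
    rewrite zE /u /N; move: z2; rewrite !(rmorphB, rmorphD, rmorphM) rmorph1 /= => z2.
    by ring: z2.
  have zu' : z' * u' = N'%:C.
    rewrite z'E /u' /N'; move: (zeta ^+ 3) w2 => om.
    rewrite !(rmorphB, rmorphD, rmorphM) rmorph1 /= => w2.
    by ring: w2.
  have u0 : u != 0.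
    apply/eqP => /[dup] u0; rewrite /u -mulNr -rmorphN.
    move=> /(complex_free im_zeta)[a0 /eqP]; rewrite oppr_eq0 => /eqP b0.
    by move: a0 z0; rewrite zE b0 mul0r addr0 => ->; rewrite mul0r addr0 eqxx.
  have u'0 : u' != 0 by apply: contra u0 => /eqP/(Z _ _ uu') ->.
  have -> : z^-1 = u * (N^-1)%:C.
    by rewrite fmorphV /= -zu; field; rewrite z0 u0.
  have -> : z'^-1 = u' * (N'^-1)%:C.
    by rewrite fmorphV /= -zu'; field; rewrite z'0 u'0.
  apply: M => //; exists N^-1, N'^-1, 0, 0; split=> //; first exact: GV.
    by rewrite mul0r addr0.
  by rewrite mul0r addr0.
Qed.

Lemma conj_zeta_zeta : conj_zeta zeta (zeta ^+ 3).
Proof.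
have [G1 GB _ _ _] := conj_tauP R.
exists 0, 0, 1, 1; rewrite rmorph0 rmorph1 !mul1r !add0r; split=> //.
by rewrite -(subrr 1); apply: GB.
Qed.

Lemma conj_zeta_real x x' : conj_tau x x' -> conj_zeta x%:C x'%:C.
Proof.
have [G1 GB _ _ _] := conj_tauP R.
move=> xx'; exists x, x', 0, 0; rewrite !mul0r !addr0; split=> //.
by rewrite -(subrr 1); apply: GB.
Qed.

(** Both fields are stable: [zeta] is the image of [zeta ^+ 2], since
    zeta^6 = zeta, and [zeta ^+ 3] is a polynomial in [zeta]. *)
Lemma conj_zeta_aut_range (z : R[i]) :
  (exists z', conj_zeta z z') <-> exists u, conj_zeta u z.
Proof.
have [_ _ GM _ _] := conj_zetaP; have GD := correspondenceD conj_zetaP.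
have Gz := conj_zeta_zeta.
have Gz2 : conj_zeta (zeta ^+ 2) zeta by rewrite {2}zeta_zeta3; apply: GM.
have Gz3 : conj_zeta (zeta ^+ 3) ((zeta ^+ 3) ^+ 3).
  by do 2!apply: (GM) => //.
split=> [[_ [x [x' [y [y' [xx' yy' -> _]]]]]]|[_ [x [x' [y [y' [xx' yy' _ ->]]]]]]].
  exists (x'%:C + y'%:C * zeta ^+ 2).
  by apply: GD; [|apply: GM => //]; apply/conj_zeta_real/conj_tau_sym.
have [x'' Gx] : exists x'', conj_tau x' x'' by exists x; apply: conj_tau_sym.
have [y'' Gy] : exists y'', conj_tau y' y'' by exists y; apply: conj_tau_sym.
exists (x''%:C + y''%:C * (zeta ^+ 3) ^+ 3).
by apply: GD; [|apply: GM => //]; apply/conj_zeta_real.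
Qed.

Lemma field_adjoin_zeta : field_adjoin zeta = [set z | exists z', conj_zeta z z'].
Proof.
apply: field_adjoin_eq.
- exact: correspondence_subfield conj_zetaP.
- by exists (zeta ^+ 3); exact: conj_zeta_zeta.
- move=> K Kf Kz _ [_ [x [_ [y [_ [[a [b [-> _]]] [c [d [-> _]]] -> _]]]]]].
  have Kr := subfield_subring Kf.
  have Kt : K tau%:C.
    have z2 := zeta_sqr; rewrite rmorphB rmorph1 in z2.
    have z0 : zeta != 0.
      by apply/eqP => z0; move: im_zeta; rewrite z0 eqxx.
    have -> : tau%:C = (zeta ^+ 2 + zeta + 1) / zeta.
      by rewrite z2; field.
    case: (Kf) => K1 _ D; apply: (D) => //; apply: subringD => //.
    by apply: subringD => //; apply: subringM.
  have Kc (p q : rat) : K (ratr p + ratr q * tau)%:C.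
    rewrite ratr_combC.
    by apply: subringD => //; [|apply: subringM => //]; apply: subfield_ratr.
  by apply: subringD => //; apply: subringM.
Qed.

(** An automorphism of Q(zeta) is determined on Q(tau) by the image of
    [zeta], because tau = (zeta^2 + zeta + 1) / zeta. *)
Lemma star5E z z' : conj_zeta z z' -> @star5 R 3 z = z'.
Proof.
move=> zz'; rewrite /star5; set S := [set s | _].
set g := xget _ S; have : S g.
  apply: xgetPex.
  have [s sK sE] := correspondence_aut conj_zetaP conj_zeta_aut_range.
  by exists s; split; [rewrite field_adjoin_zeta | apply: sE; exact: conj_zeta_zeta].
move: g => s /= []; rewrite field_adjoin_zeta.
set K := [set z | _] => sK sz.
have Kf : subfield_set K by exact: correspondence_subfield conj_zetaP.
have Kr := subfield_subring Kf.
have [_ s1 sD sM] := sK.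
have Kz : K zeta by exists (zeta ^+ 3); exact: conj_zeta_zeta.
have Kre (x x' : R) : conj_tau x x' -> K x%:C.
  by move=> xx'; exists x'%:C; exact: conj_zeta_real.
have Kt := Kre _ _ (conj_tau_tau R).
have st : s tau%:C = tau'%:C.
  have K1 : K 1 by case: Kf.
  have Kt1 := Kre _ _ (conj_tau_sym (conj_tau_tau R)).
  (* [tau] is determined by [zeta]: apply [s] to zeta^2 + zeta + 1 = tau zeta. *)
  have e : zeta ^+ 2 + (zeta + 1) = tau%:C * zeta.
    by have := zeta_sqr; rewrite rmorphB rmorph1 => ->; ring.
  have Kz1 := subringD Kr Kz K1; have Kzz := subringM Kr Kz Kz.
  have : s (zeta * zeta + (zeta + 1)) = s (tau%:C * zeta) by rewrite -e.
  rewrite (sD _ _ (mem_set Kzz) (mem_set Kz1)) (sD _ _ (mem_set Kz) (mem_set K1)).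
  rewrite (sM _ _ (mem_set Kz) (mem_set Kz)) (sM _ _ (mem_set Kt) (mem_set Kz)).
  rewrite s1 sz => e'.
  have w0 : zeta ^+ 3 != 0 by apply/eqP => w0; move: im_zeta3; rewrite w0 eqxx.
  apply: (mulIf w0); rewrite -e'.
  by have := zeta3_sqr; rewrite rmorphB rmorph1 -expr2 => ->; ring.
have sr (x x' : R) : conj_tau x x' -> s x%:C = x'%:C.
  move=> [a [b [-> ->]]]; rewrite !ratr_combC.
  have Ka := subfield_ratr a Kf; have Kb := subfield_ratr b Kf.
  rewrite (sD _ _ (mem_set Ka) (mem_set (subringM Kr Kb Kt))).
  by rewrite (sM _ _ (mem_set Kb) (mem_set Kt)) !(aut_ratr Kf sK) st.
move: zz' => [x [x' [y [y' [xx' yy' -> ->]]]]].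
have Kx := Kre _ _ xx'; have Ky := Kre _ _ yy'.
rewrite (sD _ _ (mem_set Kx) (mem_set (subringM Kr Ky Kz))).
by rewrite (sM _ _ (mem_set Ky) (mem_set Kz)) (sr _ _ xx') (sr _ _ yy') sz.
Qed.

(** Z[zeta] contains tau = 1 + zeta + zeta^4, and Z[tau] + Z[tau] zeta is
    closed under products by the quadratic equation of [zeta]. *)
Lemma Z_zeta5E : @Z_zeta5 R =
  [set z | exists x y, [/\ Z_tau x, Z_tau y & z = x%:C + y%:C * zeta]].
Proof.
have Zr := Z_tau_subring R; have z2 := zeta_sqr.
have [Z1 ZB ZM] := Zr; have Zt := Z_tau_tau R.
apply: ring_adjoin_eq.
- split.
  + by exists 1, 0; split; rewrite ?mul0r ?addr0 //; apply: subring0.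
  + move=> _ _ [a [b [Za Zb ->]]] [c [d [Zc Zd ->]]].
    exists (a - c), (b - d); split; [exact: ZB | exact: ZB|].
    by rewrite !rmorphB; ring.
  + move=> _ _ [a [b [Za Zb ->]]] [c [d [Zc Zd ->]]].
    exists (a * c - b * d), (a * d + b * c + (tau - 1) * (b * d)); split.
    * by apply: (ZB); apply: (ZM).
    * apply: subringD => //; first by apply: subringD => //; apply: (ZM).
      by apply: (ZM); [apply: ZB | apply: ZM].
    * by move: z2; rewrite !(rmorphB, rmorphD, rmorphM) rmorph1 /= => z2; ring: z2.
- exists 0, 1; rewrite rmorph0 rmorph1 mul1r add0r; split=> //; exact: subring0.
- move=> K Kr Kz _ [_ [_ [[a [b ->]] [c [d ->]] ->]]].
  have Kt : K tau%:C.
    have -> : tau%:C = 1 + zeta + zeta ^+ 4.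
      have t2 := tauC_sqr; move: z2; rewrite rmorphB rmorph1 => z2.
      by ring: z2 t2.
    apply: subringD => //; first by apply: subringD => //; case: Kr.
    by do 3!apply: subringM => //.
  have Kc (p q : int) : K (p%:~R + q%:~R * tau)%:C.
    rewrite rmorphD rmorphM !rmorph_int /=.
    by apply: subringD => //; [|apply: subringM => //]; apply: subring_int.
  by apply: subringD => //; apply: subringM.
Qed.

End Zeta.

(** * Coordinates on a plane orthogonal to (s, 0, 1) *)

Section Plane.
Variable R : realType.
Implicit Types (s r x y : R) (w z : R[i]) (v : 'cV[R]_3).

Lemma ord3_ind (P : 'I_3 -> Prop) : P 0 -> P 1 -> P 2 -> forall i, P i.
Proof.
move=> P0 P1 P2 [[|[|[|//]]] i3].
- by rewrite (_ : Ordinal i3 = 0) //; apply: val_inj.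
- by rewrite (_ : Ordinal i3 = 1) //; apply: val_inj.
- by rewrite (_ : Ordinal i3 = 2) //; apply: val_inj.
Qed.

Lemma colv3P v v' : v 0 0 = v' 0 0 -> v 1 0 = v' 1 0 -> v 2 0 = v' 2 0 -> v = v'.
Proof.
move=> e0 e1 e2; apply/matrixP => i j; rewrite (ord1 j).
by move: i; apply: ord3_ind.
Qed.

Lemma hyperplaneP s v : hyperplane (cvec 3 [:: s; 0; 1]) v <-> v 2 0 = - (s * v 0 0).
Proof.
rewrite /hyperplane /= !big_ord_recl big_ord0 /= !mxE /= mul0r mul1r add0r addr0.
rewrite (_ : lift _ (lift _ _) = 2); last exact: val_inj.
by split=> [/eqP|->]; rewrite ?subrr // addrC addr_eq0 => /eqP.
Qed.

(** With [r = tau'] and [w = zeta] this is [Phi] on the plane orthogonal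
    to (tau, 0, 1); with [r = tau] and [w = zeta ^+ 3] it is [Phi_star] on the
    conjugate plane. *)
Definition plane_coord r w v : R[i] := (v 1 0 - r * v 0 0)%:C + (- (2 * v 0 0))%:C * w.

Lemma plane_coord_linear r w a u v :
  plane_coord r w (a *: u + v) = a%:C * plane_coord r w u + plane_coord r w v.
Proof.
by rewrite /plane_coord !mxE !(rmorphB, rmorphN, rmorphD, rmorphM) /=; ring.
Qed.

(** The vector [X e + Y g] of the plane orthogonal to (s, 0, 1), where
    e = (0, 1, 0) and g = 1/2 (-1, -r, s) are the vectors that are sent to [1]
    and [w]. *)
Definition plane_point s r (X Y : R) : 'cV[R]_3 :=
  cvec 3 [:: - (Y / 2); X - r * (Y / 2); s * (Y / 2)].

Lemma plane_point_mem s r X Y : hyperplane (cvec 3 [:: s; 0; 1]) (plane_point s r X Y).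
Proof. by apply/hyperplaneP; rewrite !mxE /=; ring. Qed.

Lemma plane_coord_point s r w X Y :
  plane_coord r w (plane_point s r X Y) = X%:C + Y%:C * w.
Proof. by rewrite /plane_coord !mxE /=; congr (_%:C + _%:C * _); field. Qed.

Lemma plane_pointK s r v : hyperplane (cvec 3 [:: s; 0; 1]) v ->
  v = plane_point s r (v 1 0 - r * v 0 0) (- (2 * v 0 0)).
Proof.
by move=> /hyperplaneP v2; apply: colv3P; rewrite !mxE /= ?v2; field.
Qed.

Lemma plane_coord_inj s r w : complex.Im w != 0 ->
  {in hyperplane (cvec 3 [:: s; 0; 1]) &, injective (plane_coord r w)}.
Proof.
move=> w0 u v /set_mem hu /set_mem hv uv.
have : plane_coord r w ((-1) *: v + u) = 0.
  by rewrite plane_coord_linear uv rmorphN rmorph1 mulN1r addNr.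
move=> /(complex_free w0)[]; rewrite !mxE => e1 e0.
have v0 : u 0 0 = v 0 0 by lra.
have v1 : u 1 0 = v 1 0 by move: e1; rewrite v0; lra.
apply: colv3P => //; move/hyperplaneP: hu => ->; move/hyperplaneP: hv => ->.
by rewrite v0.
Qed.

Lemma complex_span w z : complex.Im w != 0 -> exists X Y : R, z = X%:C + Y%:C * w.
Proof.
move=> w0; case: z => p q.
exists (p - q / complex.Im w * complex.Re w), (q / complex.Im w).
by rewrite complex_combE divfK // subrK.
Qed.

Lemma plane_coord_iso s r w : complex.Im w != 0 ->
  linear_iso_onto_C (hyperplane (cvec 3 [:: s; 0; 1])) (plane_coord r w).
Proof.
move=> w0; split; last by move=> *; apply: plane_coord_linear.
split=> //; first exact: plane_coord_inj.
move=> z _; have [X [Y ->]] := complex_span z w0.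
exists (plane_point s r X Y); [exact: plane_point_mem | exact: plane_coord_point].
Qed.

(** The vectors sent to [1] and [w] form a basis of the plane. *)
Lemma plane_coord_unique s r w f : complex.Im w != 0 ->
  [/\ linear_iso_onto_C (hyperplane (cvec 3 [:: s; 0; 1])) f,
      f (cvec 3 [:: 0; 1; 0]) = 1 & f (2^-1 *: cvec 3 [:: -1; - r; s]) = w] ->
  {in hyperplane (cvec 3 [:: s; 0; 1]), f =1 plane_coord r w}.
Proof.
set H := hyperplane _ => w0 [[_ lin] f1 fw] v /set_mem Hv.
have He : H (cvec 3 [:: 0; 1; 0]) by apply/hyperplaneP; rewrite !mxE /=; ring.
have Hg : H (2^-1 *: cvec 3 [:: -1; - r; s]) by apply/hyperplaneP; rewrite !mxE /=; ring.
have H0 : H 0 by apply/hyperplaneP; rewrite !mxE; ring.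
have f0 : f 0 = 0.
  have := lin 1 0 0 H0 H0; rewrite scale1r addr0 rmorph1 mul1r => /eqP.
  by rewrite -subr_eq0 opprD addrA subrr sub0r oppr_eq0 => /eqP.
pose X := v 1 0 - r * v 0 0; pose Y := - (2 * v 0 0).
have HYg : H (Y *: (2^-1 *: cvec 3 [:: -1; - r; s]) + 0).
  by apply/hyperplaneP; rewrite !mxE /=; ring.
have -> : v = X *: cvec 3 [:: 0; 1; 0] + (Y *: (2^-1 *: cvec 3 [:: -1; - r; s]) + 0).
  move/hyperplaneP: Hv => v2.
  by apply: colv3P; rewrite !mxE /= ?v2 /X /Y; field.
rewrite lin // lin // f1 fw f0 mulr1 addr0.
by rewrite /plane_coord !mxE /=; congr (_%:C + _%:C * _); field.
Qed.

Lemma xget_plane_coord s r w : complex.Im w != 0 ->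
  {in hyperplane (cvec 3 [:: s; 0; 1]),
   xget (fun=> 0) [set f | [/\ linear_iso_onto_C (hyperplane (cvec 3 [:: s; 0; 1])) f,
      f (cvec 3 [:: 0; 1; 0]) = 1 & f (2^-1 *: cvec 3 [:: -1; - r; s]) = w]]
   =1 plane_coord r w}.
Proof.
move=> w0; apply: plane_coord_unique => //; set S := [set f | _].
suff ex : exists f, S f by exact: (xgetPex _ ex).
exists (plane_coord r w); split; first exact: plane_coord_iso.
  by rewrite /plane_coord !mxE /= !mulr0 oppr0 addr0 mul0r addr0.
rewrite /plane_coord !mxE /= (_ : _ - _ = 0); last by ring.
by rewrite (_ : - (2 * _) = 1) ?mul1r ?add0r //; field.
Qed.

Lemma PhiE v : H_tau v -> Phi v = plane_coord (tau' R) (zeta5 R) v.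
Proof.
move=> Hv.
exact: (@xget_plane_coord (tau R) (tau' R) _ (im_zeta R) v (mem_set Hv)).
Qed.

Lemma Phi_starE v : H_tau' v -> Phi_star v = plane_coord (tau R) (zeta5 R ^+ 3) v.
Proof.
move=> Hv.
exact: (@xget_plane_coord (tau' R) (tau R) _ (im_zeta3 R) v (mem_set Hv)).
Qed.

End Plane.

(** * Subgroups, and even permutations of four letters *)

Section Subgroups.
Variable V : zmodType.
Implicit Types (G S : set V).

Definition subgroup_set G := G 0 /\ forall x y, G x -> G y -> G (x - y).

Lemma zmod_closedP G : GRing.zmod_closed [in G] <-> subgroup_set G.
Proof.
split=> -[G0 GB]; split.
- by move: G0; rewrite inE.
- by move=> x y /mem_set Gx /mem_set Gy; apply: set_mem; apply: GB.
- exact: mem_set.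
- by move=> x y /set_mem Gx /set_mem Gy; apply: mem_set; apply: GB.
Qed.

Lemma subgroup_gen_subgroup S : subgroup_set (subgroup_gen S).
Proof.
split=> [G [/zmod_closedP[]]//|x y Gx Gy G hG].
case: (hG) => /zmod_closedP[_ B] _; apply: B; [exact: Gx | exact: Gy].
Qed.

Lemma subgroupN G x : subgroup_set G -> G x -> G (- x).
Proof. by move=> [G0 B] Gx; rewrite -sub0r; apply: B. Qed.

Lemma subgroupD G x y : subgroup_set G -> G x -> G y -> G (x + y).
Proof.
by move=> hG Gx Gy; rewrite -(opprK y); case: (hG) => _; apply => //; apply: subgroupN.
Qed.

Lemma subgroup_mulz G x (n : int) : subgroup_set G -> G x -> G (x *~ n).
Proof.
move=> hG Gx; have Gn (m : nat) : G (x *+ m).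
  elim: m => [|m IH]; first by case: hG.
  by rewrite mulrS; apply: subgroupD.
by case: n => m; rewrite ?NegzE ?mulrNz; [exact: Gn | apply: subgroupN => //; exact: Gn].
Qed.
End Subgroups.

Section Perm4.

Lemma ord4_ind (P : 'I_4 -> Prop) : P 0 -> P 1 -> P 2 -> P 3 -> forall i, P i.
Proof.
move=> P0 P1 P2 P3 [[|[|[|[|//]]]] i3].
- by rewrite (_ : Ordinal i3 = 0) //; apply: val_inj.
- by rewrite (_ : Ordinal i3 = 1) //; apply: val_inj.
- by rewrite (_ : Ordinal i3 = 2) //; apply: val_inj.
- by rewrite (_ : Ordinal i3 = 3) //; apply: val_inj.
Qed.

Definition swap_ord (i j k : 'I_4) := if k == i then j else if k == j then i else k.

(** Composing [s] with three swaps brings 0, 1 and 2 back to their places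
    one after the other, so the parity of [s] counts the nontrivial swaps.
    This form can be evaluated on given values of [s]. *)
Lemma odd_perm4E (s : 'S_4) (b := swap_ord (s 0) 0 (s 1)) (c := swap_ord (s 0) 0 (s 2)) :
  odd_perm s = (s 0 != 0) (+) (b != 1) (+) (swap_ord b 1 c != 2).
Proof.
pose t := (s * tperm (s 0%R) 0%R * tperm b 1%R * tperm (swap_ord b 1%R c) 2%R)%g.
have t1 : t = 1%g.
  have sE i j k : tperm i j k = swap_ord i j k by rewrite permE.
  have t0 : t 0 = 0 /\ t 1 = 1 /\ t 2 = 2.
    have : s 0 != s 1 by rewrite (inj_eq perm_inj).
    have : s 0 != s 2 by rewrite (inj_eq perm_inj).
    have : s 1 != s 2 by rewrite (inj_eq perm_inj).
    rewrite /t !permM !sE /c /b.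
    move: (s 0) (s 1) (s 2).
    by do 3!(apply: ord4_ind).
  case: t0 => t0 [t1 t2]; apply/permP => i; rewrite perm1.
  move: i; apply: ord4_ind => //.
  have : t 3 != t 0 by rewrite (inj_eq perm_inj).
  have : t 3 != t 1 by rewrite (inj_eq perm_inj).
  have : t 3 != t 2 by rewrite (inj_eq perm_inj).
  rewrite t0 t1 t2; by move: (t 3); apply: ord4_ind.
have : odd_perm t = false by rewrite t1 odd_perm1.
rewrite /t !odd_permM !odd_tperm.
by case: (odd_perm s) (_ != 0) (_ != 1) (_ != 2) => [] [] [] [].
Qed.

(** The values at 1, 2, 3 of the twelve even permutations of 0, 1, 2, 3. *)
Definition even_triples : seq (nat * nat * nat) :=
  [:: (1,2,3); (2,3,1); (3,1,2); (0,3,2); (2,0,3); (3,2,0); (0,1,3); (1,3,0);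
      (3,0,1); (0,2,1); (1,0,2); (2,1,0)]%N.

Lemma even_perm4 (s : 'S_4) : ~~ odd_perm s ->
  ((s 1 : nat), (s 2 : nat), (s 3 : nat)) \in even_triples.
Proof.
rewrite odd_perm4E /=.
have : s 0 != s 1 by rewrite (inj_eq perm_inj).
have : s 0 != s 2 by rewrite (inj_eq perm_inj).
have : s 0 != s 3 by rewrite (inj_eq perm_inj).
have : s 1 != s 2 by rewrite (inj_eq perm_inj).
have : s 1 != s 3 by rewrite (inj_eq perm_inj).
have : s 2 != s 3 by rewrite (inj_eq perm_inj).
move: (s 0) (s 1) (s 2) (s 3).
by do 4!apply: ord4_ind.
Qed.
End Perm4.

(** * The icosian modules and the plane orthogonal to (tau, 0, 1) *)

Section Icosians.
Variable R : realType.
Local Notation tau := (tau R).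
Local Notation tau' := (tau' R).
Local Notation Zt := (@Z_tau R).
Implicit Types (v u : 'cV[R]_4).

Lemma icosian_subgroup : subgroup_set (@icosian R).
Proof. exact: subgroup_gen_subgroup. Qed.

Lemma row_perm_icosian (s : 'S_4) v :
  ~~ odd_perm s -> icosian_seeds v -> icosian (row_perm s v).
Proof.
move=> hs hv G [_]; apply; exists s => //; exists v => //.
Qed.

Lemma icosian_min (G : set 'cV[R]_4) : subgroup_set G ->
  (forall (s : 'S_4) v, ~~ odd_perm s -> icosian_seeds v -> G (row_perm s v)) ->
  @icosian R `<=` G.
Proof.
move=> hG hS; apply: smallest_sub; first exact/zmod_closedP.
by move=> _ [s hs [v hv <-]]; apply: hS.
Qed.

(** Necessary conditions that cut the imaginary parts of icosians down to
    those of the plane: the last clause is the congruence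
    tau^2 beta + tau gamma + delta = 0 mod 2 for twice the vector. *)
Definition icosian_bound : set 'cV[R]_4 := [set v |
  [/\ forall i, exists x', conj_tau (v i 0) x', Zt (2 * v 1 0)
    & Zt (tau ^+ 2 * v 1 0 + tau * v 2 0 + v 3 0)]].

Lemma icosian_bound_subgroup : subgroup_set icosian_bound.
Proof.
have Zr := Z_tau_subring R; have [_ ZB _] := Zr; have Z0 := subring0 Zr.
have [_ KB _] := correspondence_subfield (conj_tauP R).
have K0 := subring0 (subfield_subring (correspondence_subfield (conj_tauP R))).
split=> [|x y [x1 x2 x3] [y1 y2 y3]].
  by split=> [i||]; rewrite !mxE ?mulr0 ?addr0.
split=> [i||]; first by rewrite !mxE; exact: KB.
  by rewrite !mxE mulrBr; apply: ZB.
rewrite !mxE; set E := (X in Zt X).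
have -> : E = (tau ^+ 2 * x 1 0 + tau * x 2 0 + x 3 0)
              - (tau ^+ 2 * y 1 0 + tau * y 2 0 + y 3 0) by rewrite /E; ring.
exact: ZB.
Qed.

Lemma Z_tau_nat n : Zt n%:R.
Proof. exact: (subring_int (Posz n) (Z_tau_subring R)). Qed.

Lemma icosian_bound_integral v : (forall i, Zt (v i 0)) -> icosian_bound v.
Proof.
move=> hv; have Zr := Z_tau_subring R; have [_ _ ZM] := Zr; have Zt := Z_tau_tau R.
split=> [i||]; first exact: Z_tau_conj.
  exact: (ZM _ _ (Z_tau_nat 2)).
apply: subringD => //; apply: subringD => //; last exact: ZM.
by apply: (ZM) => //; apply: ZM.
Qed.

Lemma conj_tau_half x : Zt x -> exists x', conj_tau (2^-1 * x) x'.
Proof.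
move=> /Z_tau_conj Kx; have Kf := correspondence_subfield (conj_tauP R).
have [_ _ KM] := subfield_subring Kf.
apply: KM Kx; have := subfield_ratr (2^-1) Kf.
by rewrite fmorphV /= ratr_nat.
Qed.

Lemma sign_half (b : bool) (x : R) : 2^-1 * ((-1) ^+ b * x) = 2^-1 * x - b%:R * x.
Proof. by case: b; rewrite /= ?expr1 ?expr0; field. Qed.

(** A change of sign alters a seed by a vector with entries in Z[tau],
    which satisfies every condition; what remains is one vector of the second
    kind and the twelve even rearrangements of one vector of the third kind. *)
Lemma icosian_sub_bound : @icosian R `<=` icosian_bound.
Proof.
have Zr := Z_tau_subring R; have [Z1 _ ZM] := Zr; have Z0 := subring0 Zr.
have Zt := Z_tau_tau R; have Zt' := Z_tau_tau' R; have t2 := tau_sqr R.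
have BB := icosian_bound_subgroup.2.
have Zsgn (b : bool) : Z_tau ((-1) ^+ b : R).
  by case: b => //; apply: subringN.
apply: icosian_min; first exact: icosian_bound_subgroup.
move=> s v hs [[[b _ <-]|[f _ <-]]|[[b1 b2] _ <-]].
- apply: icosian_bound_integral => i; rewrite !mxE.
  by move: (s i); apply: ord4_ind => /=.
- set w := row_perm _ _; pose h : 'cV[R]_4 := 2^-1 *: const_mx 1.
  have -> : w = h - \col_i (f (s i))%:R.
    by apply/matrixP => i j; rewrite !mxE -[X in _ * X]mulr1 sign_half !mulr1.
  apply: BB; last by apply: icosian_bound_integral => i; rewrite !mxE; apply: Z_tau_nat.
  split=> [i||]; rewrite !mxE; first exact: conj_tau_half.
    by rewrite mulr1 divff ?pnatr_eq0.
  by exists 1, 1; rewrite mulr1; lra.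
- set w := row_perm _ _.
  pose h : 'cV[R]_4 := row_perm s (2^-1 *: cvec 4 [:: 0; 1; tau'; tau]).
  have -> : w = h - row_perm s (cvec 4 [:: 0; b1%:R; b2%:R * tau'; 0]).
    apply/matrixP => i j; rewrite !mxE; move: (s i); apply: ord4_ind => /=.
    + by ring.
    + by rewrite -[X in _ * X = _]mulr1 sign_half !mulr1.
    + by rewrite sign_half.
    + by ring.
  apply: BB; last first.
    apply: icosian_bound_integral => i; rewrite !mxE; move: (s i).
    by apply: ord4_ind => //=; [apply: Z_tau_nat | apply: ZM => //; apply: Z_tau_nat].
  have Zc (i : 'I_4) : Z_tau ([:: 0; 1; tau'; tau]`_i : R).
    by move: i; apply: ord4_ind => /=.
  split=> [i||]; rewrite !mxE; first exact: conj_tau_half.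
    by rewrite mulrA divff ?pnatr_eq0 // mul1r.
  (* The value is 0, 1, tau or 1 + tau, according to the rearrangement. *)
  have t3 : tau ^+ 3 = 2 * tau + 1 by ring: t2.
  have := even_perm4 hs.
  move: (s 1 : nat) (s 2 : nat) (s 3 : nat) => p q r; rewrite !inE.
  do ![case/orP]; move/eqP => [-> -> ->]; rewrite /= /Defs.tau';
    solve [ exists 0, 0; rewrite mul0r addr0; lra
          | exists 1, 0; rewrite mul0r addr0; lra
          | exists 0, 1; rewrite mul1r add0r; lra
          | exists 1, 1; rewrite mul1r; lra ].
Qed.

Lemma quat_imE v : [/\ (quat_im v) 0 0 = v 1 0, (quat_im v) 1 0 = v 2 0 &
  (quat_im v) 2 0 = v 3 0].
Proof. by split; rewrite mxE; congr (v _ _); apply: val_inj. Qed.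

Lemma Im_icosian_subgroup : subgroup_set (@Im_icosian R).
Proof.
have [I0 IB] := icosian_subgroup; split.
  by exists 0 => //; apply/matrixP => i j; rewrite !mxE.
move=> _ _ [x Ix <-] [y Iy <-]; exists (x - y); first exact: IB.
by apply/matrixP => i j; rewrite !mxE.
Qed.

Lemma icosian0_subgroup : subgroup_set (@icosian0 R).
Proof.
have [I0 IB] := icosian_subgroup; split.
  exists 0; first by split=> //=; rewrite /quat_re mxE.
  by apply/matrixP => i j; rewrite !mxE.
move=> _ _ [x [Ix rx] <-] [y [Iy ry] <-]; exists (x - y).
  split; first exact: IB.
  by move: rx ry; rewrite /quat_re /= !mxE => -> ->; rewrite subrr.
by apply/matrixP => i j; rewrite !mxE.
Qed.

Lemma icosian0_sub_Im : @icosian0 R `<=` @Im_icosian R.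
Proof. by move=> _ [x [Ix _] <-]; exists x. Qed.

Lemma Im_icosian_conj (l : 'cV[R]_3) : Im_icosian l ->
  forall i, exists x', conj_tau (l i 0) x'.
Proof.
by move=> [v /icosian_sub_bound[vK _ _] <-] i; rewrite mxE; apply: vK.
Qed.

(** On the plane the congruence reads h0 + tau h1 in Z[tau], and
    multiplying by the unit -tau' turns it into h1 - tau' h0 in Z[tau]. *)
Lemma Im_icosian_plane (l : 'cV[R]_3) : Im_icosian l -> H_tau l ->
  exists X Y, [/\ Z_tau X, Z_tau Y & l = plane_point tau tau' X Y].
Proof.
have Zr := Z_tau_subring R; have [_ _ ZM] := Zr; have t2 := tau_sqr R.
move=> [v /icosian_sub_bound[_ v1 v123] lE] Hl.
exists (l 1 0 - tau' * l 0 0), (- (2 * l 0 0)); split; last exact: plane_pointK.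
  move/hyperplaneP: Hl; rewrite -lE; case: (quat_imE v) => -> -> -> v3.
  have -> : v 2 0 - tau' * v 1 0 =
    - tau' * (tau ^+ 2 * v 1 0 + tau * v 2 0 + v 3 0).
    by rewrite v3 /Defs.tau'; ring: t2.
  by apply: (ZM) => //; apply: subringN => //; apply: Z_tau_tau'.
by apply: subringN => //; rewrite -lE; case: (quat_imE v) => -> _ _.
Qed.

Lemma icosian0_intro (x y z : R) :
  icosian (cvec 4 [:: 0; x; y; z]) -> icosian0 (cvec 3 [:: x; y; z]).
Proof.
move=> Ix; exists (cvec 4 [:: 0; x; y; z]).
  by split=> //=; rewrite /quat_re mxE.
case: (quat_imE (cvec 4 [:: 0; x; y; z])) => e0 e1 e2.
by apply: colv3P; rewrite ?e0 ?e1 ?e2 !mxE.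
Qed.

Lemma plane_pointD s r (X Y X' Y' : R) :
  plane_point s r (X + X') (Y + Y') = plane_point s r X Y + plane_point s r X' Y'.
Proof. by apply: colv3P; rewrite !mxE /=; ring. Qed.

Lemma plane_pointMz s r (X Y : R) (n : int) :
  plane_point s r (n%:~R * X) (n%:~R * Y) = plane_point s r X Y *~ n.
Proof.
rewrite -[RHS]scaler_int; move: (n%:~R : R) => c.
by apply: colv3P; rewrite !mxE /=; ring.
Qed.

(** The four generators over the integers come from icosians with real
    part 0: (1, 0) from a unit vector, (0, 1) from a seed, (tau, 0) from the sum
    of two seeds that differ by signs, and (0, tau) from the relation
    tau zeta = zeta + 1 + zeta^2. *)
Lemma plane_icosian0 X Y : Z_tau X -> Z_tau Y ->
  icosian0 (plane_point tau tau' X Y).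
Proof.
have t2 := tau_sqr R; have hI := icosian0_subgroup; have hJ := icosian_subgroup.
have seed3 (b1 b2 : bool) : icosian_seeds
    (2^-1 *: cvec 4 [:: 0; (-1) ^+ b1; (-1) ^+ b2 * tau'; tau]).
  by right; exists (b1, b2).
have P10 : icosian0 (plane_point tau tau' 1 0).
  rewrite /plane_point !mul0r !mulr0 oppr0 addr0; apply: icosian0_intro.
  pose s : 'S_4 := (tperm 0%R 2%R * tperm 1%R 3%R)%g.
  rewrite (_ : cvec _ _ = row_perm s (cvec 4 [:: (-1) ^+ false; 0; 0; 0])).
    apply: row_perm_icosian; first by rewrite odd_permM !odd_tperm.
    by left; left; exists false.
  apply/matrixP => i j; rewrite !mxE permM !permE; move: i.
  by apply: ord4_ind.
have Pt0 : icosian0 (plane_point tau tau' tau 0).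
  rewrite /plane_point !mul0r !mulr0 oppr0 addr0; apply: icosian0_intro.
  pose s : 'S_4 := (tperm 0%R 1%R * tperm 2%R 3%R)%g.
  have hs : ~~ odd_perm s by rewrite odd_permM !odd_tperm.
  rewrite (_ : cvec _ _ =
    row_perm s (2^-1 *: cvec 4 [:: 0; (-1) ^+ false; (-1) ^+ false * tau'; tau]) +
    row_perm s (2^-1 *: cvec 4 [:: 0; (-1) ^+ true; (-1) ^+ true * tau'; tau])).
    by apply: (subgroupD hJ); apply: (row_perm_icosian hs); exact: seed3.
  apply/matrixP => i j; rewrite !mxE permM !permE; move: i.
  by apply: ord4_ind => /=; rewrite ?expr1 ?expr0; field.
have P01 : icosian0 (plane_point tau tau' 0 1).
  apply: icosian0_intro.
  rewrite (_ : cvec _ _ = row_perm 1%g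
    (2^-1 *: cvec 4 [:: 0; (-1) ^+ true; (-1) ^+ true * tau'; tau])).
    by apply: row_perm_icosian; [rewrite odd_perm1 | exact: seed3].
  apply/matrixP => i j; rewrite !mxE perm1; move: i.
  by apply: ord4_ind => /=; rewrite ?expr1; field.
have P0t : icosian0 (plane_point tau tau' 0 tau).
  pose s : 'S_4 := (tperm 1%R 2%R * tperm 1%R 3%R)%g.
  have hs : ~~ odd_perm s by rewrite odd_permM !odd_tperm.
  have -> : plane_point tau tau' 0 tau = plane_point tau tau' 0 1 +
    plane_point tau tau' 1 0 - cvec 3 [:: - (2^-1 * tau'); 2^-1 * tau; - 2^-1].
    (* The subtracted vector is the opposite of the preimage of zeta^2. *)
    by apply: colv3P; rewrite !mxE /= /Defs.tau'; lra.
  have [_ IB] := hI; apply: IB; first exact: subgroupD.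
  apply: icosian0_intro; rewrite (_ : cvec _ _ = row_perm s
    (2^-1 *: cvec 4 [:: 0; (-1) ^+ true; (-1) ^+ true * tau'; tau])).
    by apply: (row_perm_icosian hs); exact: seed3.
  apply/matrixP => i j; rewrite !mxE permM !permE; move: i.
  by apply: ord4_ind => /=; rewrite ?expr1; field.
move=> [m [n ->]] [p [q ->]].
have -> : plane_point tau tau' (m%:~R + n%:~R * tau) (p%:~R + q%:~R * tau) =
  plane_point tau tau' 1 0 *~ m + plane_point tau tau' tau 0 *~ n +
  (plane_point tau tau' 0 1 *~ p + plane_point tau tau' 0 tau *~ q).
  rewrite -!plane_pointMz -!plane_pointD; congr plane_point; ring.
by do 2?apply: subgroupD => //; apply: subgroup_mulz.
Qed.
End Icosians.

(** * Windows, star maps and slices *)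

(** An open nonempty set is a window as soon as it is relatively compact;
    here it lies in the image under [g] of the closure of the interior of
    [W], which is compact, hence closed. *)
Lemma window_preimage (T U : topologicalType) (f : T -> U) (g : U -> T)
    (W : set U) (x : T) : hausdorff_space T -> continuous f -> continuous g ->
  cancel f g -> window W -> W° (f x) -> window (f @^-1` W°).
Proof.
move=> hT cf cg fK [_ _ cW] Wx.
have oV : open (f @^-1` W°).
  by apply: open_comp => [? _|]; [exact: cf | exact: open_interior].
rewrite /window ((interior_id _).1 oV); split; [by exists x | exact: subset_closure |].
have cgW : compact (g @` closure W°).
  by apply: continuous_compact => //; apply: continuous_subspaceT.
apply: (subclosed_compact _ cgW); first exact: closed_closure.
rewrite ((closure_id _).1 (compact_closed hT cgW)).
apply: closure_subset => y Wy; exists (f y); last exact: fK.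
exact: subset_closure.
Qed.

Section Affine.
Variable R : realType.

Lemma affine_continuous m n (u a b : 'cV[R]_m.+1) (i j : 'I_n.+1) :
  continuous (fun y : 'cV[R]_n.+1 => u + (y i 0 *: a + y j 0 *: b)).
Proof.
move=> y.
have c k (v : 'cV[R]_m.+1) :
    {for y, continuous (fun z : 'cV[R]_n.+1 => z k 0 *: v)}.
  exact: (cvgZr_tmp (@coord_continuous R n.+1 1 k 0 y)).
exact: (cvgD (cvg_cst u) (cvgD (c i a) (c j b))).
Qed.

Lemma colv2P (v v' : 'cV[R]_2) : v 0 0 = v' 0 0 -> v 1 0 = v' 1 0 -> v = v'.
Proof.
move=> e0 e1; apply/matrixP => i j; rewrite (ord1 j).
case: i => [[|[|//]] hi].
- by rewrite (_ : Ordinal hi = 0) //; apply: val_inj.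
- by rewrite (_ : Ordinal hi = 1) //; apply: val_inj.
Qed.

Lemma affine_sliceP (V : zmodType) (A H : set V) (p : V) :
  affine_slice A p H = [set h | H h /\ A (p + h)].
Proof.
apply/seteqP; split=> [_ [x [Ax [h Hh hx]] <-]|h [Hh Ah]] /=.
  by rewrite -hx addKr hx.
by exists (p + h); [split=> //; exists h | rewrite addKr].
Qed.

Lemma translate0 (V : zmodType) (A : set V) : translate 0 A = A.
Proof.
apply/seteqP; split=> [_ [x Ax <-]|x Ax]; first by rewrite add0r.
by exists x => //; rewrite add0r.
Qed.

(** In plane coordinates a slice is the preimage of the interior of [W]
    under an affine embedding [f] of the plane, which has an affine left inverse [g]. *)
Lemma window_plane_slice (s r : R) (w : R[i]) (W : set 'cV[R]_3) (p : 'cV[R]_3) :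
  complex.Im w != 0 -> window W -> W° p ->
  window (@C_to_R2 R @` (plane_coord r w @`
    affine_slice W° p (hyperplane (cvec 3 [:: s; 0; 1])))).
Proof.
move=> w0 hW Wp.
pose f (y : 'cV[R]_2) := p + (y 0 0 *: plane_point s r 1 0 +
  y 1 0 *: plane_point s r (- (complex.Re w / complex.Im w)) (complex.Im w)^-1).
pose g (x : 'cV[R]_3) := - C_to_R2 (plane_coord r w p) +
  (x 0 0 *: C_to_R2 (- r%:C - 2 * w) + x 1 0 *: C_to_R2 1).
have gE x : g x = C_to_R2 (plane_coord r w (x - p)).
  rewrite /g /C_to_R2 /plane_coord; clear; case: w => wr wi.
  by apply: colv2P; rewrite !mxE /=; ring.
have fE y : f y = p + plane_point s r (y 0 0 - y 1 0 * (complex.Re w / complex.Im w))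
    (y 1 0 / complex.Im w).
  by apply: colv3P; rewrite !mxE /=; ring.
have fK : cancel f g.
  move=> y; rewrite gE fE addrC addKr plane_coord_point complex_combE.
  by apply: colv2P; rewrite !mxE /=; field.
suff -> : @C_to_R2 R @` (plane_coord r w @`
    affine_slice W° p (hyperplane (cvec 3 [:: s; 0; 1]))) = f @^-1` W°.
  apply: (@window_preimage _ _ f g _ 0) => //.
  - exact: affine_continuous.
  - exact: affine_continuous.
  - by rewrite /f !mxE !scale0r !addr0.
rewrite affine_sliceP; apply/seteqP; split => [_ [_ [h [Hh Wh] <-] <-]|y] /=.
  suff -> : f (C_to_R2 (plane_coord r w h)) = p + h by [].
  rewrite fE [in RHS](plane_pointK r Hh) /plane_coord complex_combE !mxE /=.
  by congr (_ + plane_point _ _ _ _); field.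
rewrite fE; set h := plane_point _ _ _ _ => Wy.
exists (plane_coord r w h); first by exists h => //; split=> //; exact: plane_point_mem.
by rewrite -[RHS]fK gE fE addrC addKr.
Qed.

End Affine.

Section Main.
Variable R : realType.
Local Notation tau := (tau R).
Local Notation tau' := (tau' R).
Local Notation zeta := (zeta5 R).

Lemma starD (u v : 'cV[R]_3) : Im_icosian u -> Im_icosian v ->
  star (u + v) = star u + star v.
Proof.
move=> /Im_icosian_conj Ku /Im_icosian_conj Kv; apply/matrixP => i j.
rewrite !mxE (ord1 j); have [u' uu'] := Ku i; have [v' vv'] := Kv i.
rewrite (galois_tauE uu') (galois_tauE vv').
exact/galois_tauE/(correspondenceD (conj_tauP R)).
Qed.

(** Conjugation exchanges the plane orthogonal to (tau, 0, 1) and the one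
    orthogonal to (tau', 0, 1). *)
Lemma star_plane_point X X' Y Y' : conj_tau X X' -> conj_tau Y Y' ->
  star (plane_point tau tau' X Y) = plane_point tau' tau X' Y'.
Proof.
move=> XX YY; have [_ GB GM _ _] := conj_tauP R; have Gt := conj_tau_tau R.
have GN (x x' : R) : conj_tau x x' -> conj_tau (- x) (- x').
  have G0 : conj_tau (0 : R) 0 by exists 0, 0; rewrite rmorph0 !mul0r addr0.
  by move=> xx; have := GB _ _ _ _ G0 xx; rewrite !sub0r.
have Gh : conj_tau (Y / 2) (Y' / 2).
  apply: GM => //; exists (2^-1), 0.
  by rewrite rmorph0 !mul0r !addr0 fmorphV /= ratr_nat.
apply: colv3P; rewrite !mxE /=; apply: galois_tauE; first exact: GN.
  by apply: GB => //; apply: GM => //; apply: conj_tau_sym.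
exact: GM.
Qed.

Lemma H_tau_point X Y : H_tau (plane_point tau tau' X Y).
Proof. exact: plane_point_mem. Qed.

Lemma H_tau'_point X Y : H_tau' (plane_point tau' tau X Y).
Proof. exact: plane_point_mem. Qed.

Section Module.
Variable L : set 'cV[R]_3.
Hypothesis hL : L = @Im_icosian R \/ L = @icosian0 R.

Lemma module_subgroup : subgroup_set L.
Proof. by case: hL => ->; [exact: Im_icosian_subgroup|exact: icosian0_subgroup]. Qed.

Lemma module_sub_Im : L `<=` @Im_icosian R.
Proof. by case: hL => -> //; exact: icosian0_sub_Im. Qed.

Lemma module_planeP h : L h /\ H_tau h <->
  exists X Y, [/\ Z_tau X, Z_tau Y & h = plane_point tau tau' X Y].
Proof.
split=> [[/module_sub_Im Lh Hh]|[X [Y [ZX ZY ->]]]]; first exact: Im_icosian_plane.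
split; last exact: H_tau_point.
have := plane_icosian0 ZX ZY.
by case: hL => -> //; exact: icosian0_sub_Im.
Qed.

Lemma Phi_module : @Phi R @` (L `&` @H_tau R) = @Z_zeta5 R.
Proof.
rewrite Z_zeta5E; apply/seteqP; split=> [_ [h /module_planeP[X [Y [ZX ZY ->]]] <-]|].
  exists X, Y; split=> //.
  by rewrite PhiE ?plane_coord_point //; exact: H_tau_point.
move=> _ [X [Y [ZX ZY ->]]]; exists (plane_point tau tau' X Y).
  by apply/module_planeP; exists X, Y.
by rewrite PhiE ?plane_coord_point //; exact: H_tau_point.
Qed.

Lemma Phi_star_star h : L h -> H_tau h ->
  H_tau' (star h) /\ star5 3 (Phi h) = Phi_star (star h).
Proof.
move=> Lh Hh; have /module_planeP[X [Y [ZX ZY ->]]] : L h /\ H_tau h by [].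
have [X' XX'] := Z_tau_conj ZX; have [Y' YY'] := Z_tau_conj ZY.
rewrite (star_plane_point XX' YY'); split; first exact: H_tau'_point.
rewrite (PhiE (H_tau_point _ _)) (Phi_starE (H_tau'_point _ _)) !plane_coord_point.
by apply: star5E; exists X, X', Y, Y'.
Qed.

Lemma Phi_star_inj : {in @H_tau' R &, injective (@Phi_star R)}.
Proof.
move=> u v /[dup] hu /set_mem Hu /[dup] hv /set_mem Hv.
by rewrite !Phi_starE //; exact: (@plane_coord_inj R tau' tau _ (im_zeta3 R) u v hu hv).
Qed.

(** The model set [A] may be described by [U = W] or, when the window is
    generic, by the interior of [W]; the two choices give the identity and the
    cyclotomic window. *)
Lemma Phi_slice (A U : set 'cV[R]_3) (p : 'cV[R]_3) (q : 'cV[R]_3) :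
  (forall h, A (q + h) <-> L h /\ U (p + star h)) ->
  @Phi R @` affine_slice A q (@H_tau R) =
  [set z | Z_zeta5 z /\ (@Phi_star R @` affine_slice U p (@H_tau' R)) (star5 3 z)].
Proof.
move=> AU; rewrite !affine_sliceP -Phi_module; apply/seteqP; split.
  move=> _ [h [Hh /AU[Lh Uh]] <-]; split; first by exists h.
  by have [Hs ->] := Phi_star_star Lh Hh; exists (star h).
move=> _ [[h [Lh Hh] <-] [k [Hk Uk]]]; have [Hs ->] := Phi_star_star Lh Hh.
move=> /(Phi_star_inj (mem_set Hk) (mem_set Hs)) kh.
by exists h => //; split=> //; apply/AU; rewrite -kh.
Qed.

End Module.
End Main.

Theorem proposition3p16 (R : realType) (L : set 'cV[R]_3)
    (hL : L = @Im_icosian R \/ L = @icosian0 R)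
    (t : 'cV[R]_3) (W : set 'cV[R]_3)
    (hW : window W) (hgen : generic_window L W) :
  (forall lambda : 'cV[R]_3, ico_model_set L t W lambda ->
     @Phi R @` affine_slice (ico_model_set L t W) lambda (@H_tau R) =
     [set z | Z_zeta5 z /\ W_slice W t lambda (star5 3 z)]) /\
  (forall lambda : 'cV[R]_3, ico_model_set L t W lambda ->
     is_cyclotomic_model_set5
       (@Phi R @` affine_slice (ico_model_set L t W) lambda (@H_tau R))).
Proof.
have [_ LB] := module_subgroup hL; have LD := subgroupD (module_subgroup hL).
have Lstar l h : L l -> L h -> star (l + h) = star l + star h.
  by move=> /(module_sub_Im hL) Il /(module_sub_Im hL) Ih; apply: starD.
have memE l h : L l -> ico_model_set L t W (t + l + h) <->
    L h /\ W (star l + star h).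
  move=> Ll; split=> [[x [Lx Wx]]|[Lh Wh]].
    rewrite -addrA => /addrI xE.
    have Lh : L h by rewrite -(addKr l h) -xE addrC; apply: LB.
    by split=> //; rewrite -Lstar // -xE.
  exists (l + h); last by rewrite addrA.
  by split; [exact: LD | rewrite Lstar].
split=> _ [l [Ll Wl] <-].
  rewrite /W_slice (_ : t + l - t = l); last by rewrite addrC addKr.
  by apply: (Phi_slice hL) => h; exact: memE.
(* By genericity no star image of a point of [L] lies in the boundary. *)
have LW x : L x -> W (star x) -> W° (star x).
  move=> Lx Wx; apply: contrapT => nWx; have : set0 (star x); last by [].
  rewrite -hgen; split; last by exists x.
  split=> //; exact: subset_closure.
exists 3%N, 0, (@Phi_star R @` affine_slice W° (star l) (@H_tau' R)); split.
- by left.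
- have -> : @Phi_star R @` affine_slice W° (star l) (@H_tau' R) =
    plane_coord (tau R) (zeta5 R ^+ 3) @` affine_slice W° (star l) (@H_tau' R).
    by apply: eq_imagel => h; rewrite affine_sliceP => -[Hh _]; rewrite Phi_starE.
  apply: window_plane_slice => //; [exact: im_zeta3 | exact: LW].
- rewrite translate0.
  apply: (Phi_slice hL) => h; rewrite memE //; split=> -[Lh Wh]; split=> //.
    by rewrite -Lstar //; apply: LW; [exact: LD | rewrite Lstar].
  exact: interior_subset.
Qed.
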